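(* Let $n\ge 2$ be an integer, let $r>0$, let $\overline B_r\subset\mathbb R^n$ be a closed ball of radius $r$, and let $f:\overline B_r\to\mathbb R$ be a $C^2$ function. Let $M=\{(x,f(x)) : x\in\overline B_r\}\subset\mathbb R^{n+1}$ be its graph. If the mean curvature $H$ of $M$ does not change sign, then $$\inf_M|A|<\frac nr,$$ where $|A|$ is the length of the second fundamental form of $M$ in $\mathbb R^{n+1}$.
   Context: A $C^2$ function on a closed ball is understood to be $C^2$ up to the boundary (i.e. it is the restriction of a $C^2$ function defined on an open neighborhood of the closed ball). The graph $M$ is oriented by a choice of continuous unit normal field. Let $A$ denote the shape operator of $M$ and $k_1(p)\le\dots\le k_n(p)$ the principal curvatures (eigenvalues of $A$) at $p\in M$. The mean curvature is $H=\frac1n\sum_{i=1}^n k_i$, and the length of the second fundamental form is $|A|(p)=\big(\operatorname{trace}A^2(p)\big)^{1/2}=\big(\sum_{i=1}^n k_i(p)^2\big)^{1/2}$. ''$H$ does not change sign'' means that either $H\ge0$ everywhere on $M$ or $H\le 0$ everywhere on $M$. *)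

(* Defs.v *)
From HB Require Import structures.
From mathcomp Require Export all_boot all_order all_algebra.
From mathcomp Require Export all_classical all_reals all_analysis.
Export Order.TTheory GRing.Theory Num.Theory.
Export numFieldNormedType.Exports.

Set Implicit Arguments.
Unset Strict Implicit.
Unset Printing Implicit Defensive.

Local Open Scope classical_set_scope.
Local Open Scope ring_scope.

Definition dotprod (R : realType) (n : nat) (u v : 'rV[R]_n) : R :=
  \sum_i u 0 i * v 0 i.

(* The norm of the library on 'rV[R]_n is the sup norm; it induces the same
   topology and differentials, but its balls are cubes. *)
Definition enorm (R : realType) (n : nat) (u : 'rV[R]_n) : R :=
  Num.sqrt (dotprod u u).

Definition eclosed_ball (R : realType) (n : nat) (c : 'rV[R]_n) (r : R) :
    set 'rV[R]_n :=
  [set x | enorm (x - c) <= r].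

Definition gradient (R : realType) (n : nat) (f : 'rV[R]_n -> R)
    (x : 'rV[R]_n) : 'rV[R]_n :=
  \row_i 'D_(delta_mx 0 i) f x.

Definition C2_on (R : realType) (n : nat) (U : set 'rV[R]_n)
    (f : 'rV[R]_n -> R) : Prop :=
  forall x, U x ->
    [/\ differentiable f x,
        differentiable (gradient f) x
      & {for x, continuous (fun y => 'J (gradient f) y)}].

Definition graph_map (R : realType) (n : nat) (f : 'rV[R]_n -> R)
    (x : 'rV[R]_n) : 'rV[R]_(n + 1) :=
  row_mx x (f x)%:M.

(* A field along the graph over U is given as a function of the base point x;
   the tangent space at (x, f x) is the range of v |-> 'D_v (graph_map f) x. *)
Definition unit_normal_field (R : realType) (n : nat) (U : set 'rV[R]_n)
    (f : 'rV[R]_n -> R) (N : 'rV[R]_n -> 'rV[R]_(n + 1)) : Prop :=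
  forall x, U x ->
    [/\ {for x, continuous N},
        enorm (N x) = 1
      & forall v : 'rV[R]_n, dotprod (N x) ('D_v (graph_map f) x) = 0].

(* Matrix of the shape operator v |-> - dN(v) in the basis of the tangent space
   formed by the partial derivatives of graph_map f, acting on row vectors of
   coordinates. The rows of 'J (graph_map f) x are these basis vectors, so S
   is the only matrix with S *m 'J (graph_map f) x = - 'J N x. *)
Definition shape_operator (R : realType) (n : nat) (f : 'rV[R]_n -> R)
    (N : 'rV[R]_n -> 'rV[R]_(n + 1)) (x : 'rV[R]_n) : 'M[R]_n :=
  - 'J N x *m pinvmx ('J (graph_map f) x).

(* The eigenvalues counted with multiplicity, in nondecreasing order. The
   default value of xget is irrelevant: the shape operator is self-adjoint for
   the induced metric, so its characteristic polynomial splits over R. *)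
Definition principal_curvatures (R : realType) (n : nat) (f : 'rV[R]_n -> R)
    (N : 'rV[R]_n -> 'rV[R]_(n + 1)) (x : 'rV[R]_n) : n.-tuple R :=
  xget [tuple 0 | _ < n]
    [set k : n.-tuple R | sorted <=%R k /\
       char_poly (shape_operator f N x) = \prod_(a <- k) ('X - a%:P)].

Definition mean_curvature (R : realType) (n : nat) (f : 'rV[R]_n -> R)
    (N : 'rV[R]_n -> 'rV[R]_(n + 1)) (x : 'rV[R]_n) : R :=
  n%:R^-1 * \sum_(i < n) tnth (principal_curvatures f N x) i.

Definition second_form_length (R : realType) (n : nat) (f : 'rV[R]_n -> R)
    (N : 'rV[R]_n -> 'rV[R]_(n + 1)) (x : 'rV[R]_n) : R :=
  Num.sqrt (\tr (shape_operator f N x *m shape_operator f N x)).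

(* Main.v *)
(* Write N = (-nu grad f, nu) for the unit normal along the graph and
   G = 1 + (grad f)^T (grad f) for the induced metric; then
   nu^2 (1 + |grad f|^2) = 1 and the shape operator S satisfies S G = nu Hess f.
   For s = 1 or -1, take a maximum x of s f + sqrt(r^2 - |x - c|^2) on the ball. It is
   not on the boundary, because the hemisphere is vertical there. At x the graph
   touches a hemisphere of radius r from one side, so the principal curvatures, up to
   a sign determined by s and nu, are at most 1/r. Choose s so that, with this same
   sign, their sum is nonnegative. Then the maximum of their sum of squares is
   attained at a vertex of a simplex and is at most n (n - 1) / r^2 < (n/r)^2. *)
Require Import Defs.
From mathcomp Require Import complex ring lra.

Set Implicit Arguments.
Unset Strict Implicit.
Unset Printing Implicit Defensive.

Local Open Scope classical_set_scope.
Local Open Scope ring_scope.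

(** * Linear algebra *)

Section LinearAlgebra.
Context {R : realType} {n : nat}.
Implicit Types (u v w : 'rV[R]_n) (A S G h : 'M[R]_n).

Lemma dotprodE u v : dotprod u v = (u *m v^T) 0 0.
Proof. by rewrite mxE; apply: eq_bigr => i _; rewrite mxE. Qed.

Lemma dotprodC u v : dotprod u v = dotprod v u.
Proof. by apply: eq_bigr => i _; rewrite mulrC. Qed.

Lemma dotprodDl u v w : dotprod (u + v) w = dotprod u w + dotprod v w.
Proof. by rewrite !dotprodE mulmxDl mxE. Qed.

Lemma dotprodZl (a : R) u v : dotprod (a *: u) v = a * dotprod u v.
Proof. by rewrite !dotprodE -scalemxAl mxE. Qed.

Lemma dotprodNl u v : dotprod (- u) v = - dotprod u v.
Proof. by rewrite -scaleN1r dotprodZl mulN1r. Qed.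

Lemma dotprodZr (a : R) u v : dotprod u (a *: v) = a * dotprod u v.
Proof. by rewrite !(dotprodC u) dotprodZl. Qed.

Lemma dotprodNr u v : dotprod u (- v) = - dotprod u v.
Proof. by rewrite !(dotprodC u) dotprodNl. Qed.

Lemma dotprod_ge0 u : 0 <= dotprod u u.
Proof. by apply: sumr_ge0 => i _; rewrite -expr2 sqr_ge0. Qed.

Lemma dotprod_eq0 u : (dotprod u u == 0) = (u == 0).
Proof.
apply/eqP/eqP => [|->]; last by rewrite dotprodE mul0mx mxE.
move=> /eqP; rewrite psumr_eq0 => [/allP h|i _]; last by rewrite -expr2 sqr_ge0.
apply/rowP => i; rewrite mxE; have := h i (mem_index_enum _).
by rewrite -expr2 sqrf_eq0 => /eqP.
Qed.

Lemma dotprod_gt0 u : u != 0 -> 0 < dotprod u u.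
Proof. by move=> u0; rewrite lt_neqAle eq_sym dotprod_eq0 u0 dotprod_ge0. Qed.

Lemma dotprod_delta u i : dotprod u (delta_mx 0 i) = u 0 i.
Proof.
rewrite /dotprod (bigD1 i)//= mxE !eqxx mulr1 big1 ?addr0// => j ji.
by rewrite mxE (negPf ji) andbF mulr0.
Qed.

Lemma dotprod_mulmx_sym A u v : A^T = A -> dotprod (u *m A) v = dotprod (v *m A) u.
Proof. by move=> AT; rewrite dotprodC !dotprodE trmx_mul AT mulmxA. Qed.

(** The matrix [S] is self-adjoint for the metric [G]. Split a complex eigenvector into its real
    part [x] and imaginary part [y], and its eigenvalue into [a + ib]. The symmetry of [h] and [G]
    forces [b = 0], and whichever of [x], [y] is nonzero is then a real eigenvector. *)
Lemma pencil_eigenvalue_real S G h (a : R[i]) :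
  S *m G = h -> G^T = G -> h^T = h ->
  (forall u : 'rV[R]_n, u != 0 -> 0 < dotprod (u *m G) u) ->
  eigenvalue (map_mx (real_complex R) S) a ->
  exists2 k : R, a = (real_complex R) k &
    exists2 u : 'rV[R]_n, u != 0 & u *m h = k *: (u *m G).
Proof.
move=> SGh GT hT Gpos /eigenvalueP[z zS z0].
pose x : 'rV[R]_n := \row_j complex.Re (z 0 j).
pose y : 'rV[R]_n := \row_j complex.Im (z 0 j).
have zE j : z 0 j = Complex (x 0 j) (y 0 j) by rewrite !mxE; case: (z 0 j).
case: a zS => a b zS.
have zSE j : \sum_i z 0 i * real_complex R (S i j) =
    Complex ((x *m S) 0 j) ((y *m S) 0 j).
  rewrite !mxE; elim/big_rec3: _ => // i s1 s2 s3 _ ->.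
  by rewrite zE; apply/eqP; rewrite eq_complex /= !mulr0 subr0 add0r !eqxx.
have eqz j : (x *m S) 0 j = a * x 0 j - b * y 0 j /\
             (y *m S) 0 j = a * y 0 j + b * x 0 j.
  have /rowP/(_ j) := zS; rewrite [LHS]mxE [RHS]mxE zE.
  under eq_bigr do rewrite mxE.
  by rewrite zSE => -[-> ->].
have xS : x *m h = a *: (x *m G) - b *: (y *m G).
  have -> : h = S *m G by [].
  rewrite mulmxA (_ : x *m S = a *: x - b *: y); last first.
    by apply/rowP => j; rewrite (eqz j).1 !mxE.
  by rewrite mulmxBl -!scalemxAl.
have yS : y *m h = a *: (y *m G) + b *: (x *m G).
  have -> : h = S *m G by [].
  rewrite mulmxA (_ : y *m S = a *: y + b *: x); last first.
    by apply/rowP => j; rewrite (eqz j).2 !mxE.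
  by rewrite mulmxDl -!scalemxAl.
have xy0 : (x != 0) || (y != 0).
  rewrite -negb_and; apply: contra z0 => /andP[/eqP x0 /eqP y0].
  by apply/eqP/rowP => j; rewrite zE x0 y0 !mxE.
have Gge0 u : 0 <= dotprod (u *m G) u.
  by have [->|/Gpos/ltW//] := eqVneq u 0; rewrite dotprodE !mul0mx mxE.
(* Pairing [x *m h] with [y] and [y *m h] with [x] gives the same number. The terms in [a] cancel,
   which leaves [b] times a positive sum. *)
have b0 : b = 0.
  have := dotprod_mulmx_sym x y hT.
  rewrite xS yS !dotprodDl dotprodNl !dotprodZl (dotprod_mulmx_sym x y GT) => e.
  have {}e : b * (dotprod (x *m G) x + dotprod (y *m G) y) = 0 by lra.
  move/eqP: e; rewrite mulf_eq0 => /orP[/eqP//|].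
  by rewrite gt_eqF//; case/orP: xy0 => /Gpos; have := Gge0 x; have := Gge0 y; lra.
move: xS yS; rewrite b0 !scale0r subr0 addr0 => xS yS.
exists a => //; case/orP: xy0 => ?; first by exists x.
by exists y.
Qed.

End LinearAlgebra.

Lemma char_poly_similar (F : fieldType) n (P A : 'M[F]_n) : P \in unitmx ->
  char_poly (P *m A *m invmx P) = char_poly A.
Proof.
move=> Pu; rewrite /char_poly /char_poly_mx !map_mxM.
set Q := map_mx polyC P; set Qi := map_mx polyC (invmx P).
have QQi : Q *m Qi = 1%:M by rewrite -map_mxM mulmxV // map_mx1.
rewrite -[X in \det (X - _)]mulmx1 -QQi mulmxA -scalar_mxC.
by rewrite -mulmxBl -mulmxBr !det_mulmx mulrC mulrA -det_mulmx mulmx1C// det1 mul1r.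
Qed.

Lemma mxtrace_trig_sqr (F : comNzRingType) n (T : 'M[F]_n) : is_trig_mx T ->
  \tr (T *m T) = \sum_i T i i ^+ 2.
Proof.
move=> /is_trig_mxP Tt; apply: eq_bigr => i _; rewrite mxE (bigD1 i)//= big1 ?addr0//.
move=> j; rewrite -val_eqE; case: (ltgtP i j) => [ij _|ji _|->]; last by rewrite eqxx.
  by rewrite Tt ?mul0r.
by rewrite [X in _ * X]Tt ?mulr0.
Qed.

(** Schur triangulation over [R[i]] suffices: the diagonal entries are eigenvalues of [S], hence
    real, and the diagonal of a triangular matrix determines both its characteristic polynomial and
    the trace of its square. The identities are proved over [R[i]] and pulled back along the
    injective real embedding. *)
Lemma pencil_spectrum (R : realType) n (S G h : 'M[R]_n) : (0 < n)%N ->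
  S *m G = h -> G^T = G -> h^T = h ->
  (forall u : 'rV[R]_n, u != 0 -> 0 < dotprod (u *m G) u) ->
  exists k : n.-tuple R,
   [/\ char_poly S = \prod_(a <- k) ('X - a%:P),
       \tr (S *m S) = \sum_(a <- k) a ^+ 2 &
       forall a, a \in k -> exists2 u : 'rV[R]_n, u != 0 & u *m h = a *: (u *m G)].
Proof.
move=> n0 SGh GT hT Gpos.
pose Sc := map_mx (real_complex R) S.
have [P Pu Tt] := Schur Sc n0.
have {}Pu := unitarymx_unit Pu.
pose T := conjmx P Sc.
have TE : T = P *m Sc *m invmx P by rewrite /T conjumx.
have cT : char_poly Sc = \prod_(i < n) ('X - (T i i)%:P).
  by rewrite -(char_poly_trig Tt) -/T TE char_poly_similar.
have ev i : eigenvalue Sc (T i i).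
  by rewrite eigenvalue_root_char cT (bigD1 i)//= rootM root_XsubC eqxx.
pose k := [tuple complex.Re (T i i) | i < n].
have kE i : T i i = real_complex R (tnth k i).
  have [a Ta _] := pencil_eigenvalue_real SGh GT hT Gpos (ev i).
  by rewrite tnth_mktuple Ta.
move: k kE => k kE; exists k; split.
- apply: (map_poly_inj (real_complex R)).
  rewrite map_char_poly -/Sc cT rmorph_prod/= big_tuple.
  by apply: eq_bigr => i _; rewrite rmorphB/= map_polyX map_polyC /= kE.
- apply: (@complexI R); rewrite -trace_map_mx map_mxM rmorph_sum/= big_tuple.
  transitivity (\tr (T *m T)); last first.
    by rewrite mxtrace_trig_sqr//; apply: eq_bigr => i _; rewrite kE rmorphXn.
  rewrite TE !mulmxA (mulmxKV Pu) [RHS]mxtrace_mulC.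
  by rewrite -(mulmxA P) (mulKmx Pu).
- move=> a /tnthP[i ->].
  have [b Tb ?] := pencil_eigenvalue_real SGh GT hT Gpos (ev i).
  by move: (kE i); rewrite Tb => /complexI <-.
Qed.

(** In terms of the gaps [b - a >= 0], whose sum is [D = n b - s <= n b], the sum of the squared
    gaps is at most [D ^+ 2]. Expanding bounds the sum of the [a ^+ 2] by [D (D - 2 b) + n b ^+ 2].
    The extreme case has [n - 1] entries equal to [b] and one equal to [- (n - 1) b]. *)
Lemma sum_sqr_le (R : realType) n (k : n.-tuple R) (b : R) : (2 <= n)%N ->
  0 <= b ->
  (forall a, a \in k -> a <= b) -> 0 <= \sum_(a <- k) a ->
  \sum_(a <- k) a ^+ 2 <= n%:R * (n%:R - 1) * b ^+ 2.
Proof.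
move=> n2 b0 kb; set s := \sum_(a <- k) a => s0.
have sD : \sum_(a <- k) (b - a) = n%:R * b - s.
  by rewrite sumrB big_const_seq count_predT size_tuple iter_addr_0 mulr_natl.
have D0 : 0 <= \sum_(a <- k) (b - a).
  by rewrite big_seq sumr_ge0// => a /kb; rewrite subr_ge0.
have le2 (l : seq R) : (forall a, a \in l -> a <= b) ->
    0 <= \sum_(a <- l) (b - a) /\
    \sum_(a <- l) (b - a) ^+ 2 <= (\sum_(a <- l) (b - a)) ^+ 2.
  elim: l => [|a l IH] H; first by rewrite !big_nil expr0n.
  have [|h0 h1] := IH; first by move=> x xl; apply: H; rewrite in_cons xl orbT.
  have := H a (mem_head _ _); rewrite -subr_ge0 !big_cons => ab.
  split; first exact: addr_ge0.
  by rewrite [leRHS]sqrrD mulr2n; have := mulr_ge0 ab h0; lra.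
have [_] := le2 k kb; set D := \sum_(a <- k) (b - a) in sD D0 *.
have -> : \sum_(a <- k) (b - a) ^+ 2 = n%:R * b ^+ 2 - 2 * b * s + \sum_(a <- k) a ^+ 2.
  rewrite /s mulr_sumr; transitivity (\sum_(a <- k) (b ^+ 2 - 2 * b * a + a ^+ 2)).
    by apply: eq_bigr => a _; ring.
  rewrite big_split sumrB/= big_const_seq count_predT size_tuple iter_addr_0.
  by rewrite (mulr_natl (b ^+ 2)).
have n2' : 2 <= n%:R :> R by rewrite ler_nat.
set N := n%:R in sD n2' *.
move=> H; have sE : s = N * b - D by lra.
(* The difference of the two sides is [(N b - D) (D + (N - 2) b)], the sum of the two nonnegative
   products below. *)
have : D * (D - 2 * b) <= N * b * ((N - 2) * b).
  have : 0 <= (N * b - D) * D by rewrite mulr_ge0// -sE.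
  have : 0 <= (N * b - D) * ((N - 2) * b) by rewrite mulr_ge0 -?sE// mulr_ge0//; lra.
  by nra.
by nra.
Qed.

(** * Differential calculus on row vectors *)

(** The unit normal and its last coordinate have explicit formulas only near points of [U].
    Differentiability is transferred from these formulas, since the first-order expansion depends
    only on values near [x]. *)
Lemma near_eq_differentiable (R : numFieldType) (V W : normedModType R)
    (f g : V -> W) (x : V) :
  (\near x, f x = g x) -> differentiable f x -> differentiable g x.
Proof.
move=> fg df.
have /diff_locallyP[dc /eqaddoP fo] := df.
have gx : g x = f x by rewrite (nbhs_singleton fg).
have go : g \o shift x = cst (g x) + 'd f x +o_ 0 id.
  apply/eqaddoP => e e0; have := fo e e0.
  have : \forall h \near (0 : V), f (h + x) = g (h + x).
    by rewrite (near_shift x)/=; near do rewrite /= sub0r addrNK.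
  by apply: filterS2 => h /= fgh; rewrite -gx !fctE /= fgh.
apply/diff_locallyP; rewrite (diff_unique dc go); split => //.
Unshelve. all: by end_near. Qed.

Section Line.
Context {R : realType} {n : nat}.
Implicit Types (f : 'rV[R]_n -> R) (x v : 'rV[R]_n).

Lemma is_derive_line f x v t : differentiable f (x + t *: v) ->
  is_derive t 1 (fun s : R => f (x + s *: v)) ('D_v f (x + t *: v)).
Proof.
move=> df.
have dl : is_diff t (fun s : R => x + s *: v) (fun s : R => s *: v).
  by apply: is_diff_eq; rewrite add0r.
have dc : is_diff t (f \o (fun s : R => x + s *: v))
    ('d f (x + t *: v) \o (fun s : R => s *: v)).
  exact: is_diff_comp.
apply: DeriveDef; first by apply: diff_derivable; case: dc.
by rewrite deriveE; [rewrite diff_val/= scale1r deriveE | case: dc].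
Qed.

Lemma derive_gradient f x v : differentiable f x ->
  'D_v f x = dotprod v (gradient f x).
Proof.
move=> df; rewrite deriveE// [v in LHS]row_sum_delta linear_sum.
by apply: eq_bigr => i _; rewrite linearZ mxE deriveE.
Qed.

Lemma derive_coord m (F : 'rV[R]_n -> 'rV[R]_m) x w i : differentiable F x ->
  'D_w (fun y => F y 0 i) x = ('D_w F x) 0 i.
Proof. by move=> dF; rewrite derive_mx ?mxE//; exact: diff_derivable. Qed.

Lemma differentiable_coordE m (F : 'rV[R]_n -> 'rV[R]_m) x i : differentiable F x ->
  differentiable (fun y => F y 0 i) x.
Proof.
move=> dF; apply: (@differentiable_comp _ _ _ _ F (fun M : 'rV[R]_m => M 0 i)) => //.
exact: differentiable_coord.
Qed.

Lemma differentiable_rV m (F : 'rV[R]_n -> 'rV[R]_m) x :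
  (forall i, differentiable (fun y => F y 0 i) x) -> differentiable F x.
Proof.
move=> dF; rewrite (_ : F = \sum_i (fun y => F y 0 i *: delta_mx 0 i)).
  by apply: differentiable_sum => i; exact: differentiableZl.
by apply/funext => y; rewrite fct_sumE -row_sum_delta.
Qed.

Lemma differentiable_dotprod m (F G : 'rV[R]_n -> 'rV[R]_m) x :
  differentiable F x -> differentiable G x ->
  differentiable (fun y => dotprod (F y) (G y)) x.
Proof.
move=> dF dG; rewrite (_ : (fun _ => _) =
    \sum_i ((fun y => F y 0 i) * (fun y => G y 0 i))); last first.
  by apply/funext => y; rewrite fct_sumE.
by apply: differentiable_sum => i; apply: differentiableM; exact: differentiable_coordE.
Qed.

Lemma derive_dotprod m (F G : 'rV[R]_n -> 'rV[R]_m) x w :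
  differentiable F x -> differentiable G x ->
  'D_w (fun y => dotprod (F y) (G y)) x =
  dotprod ('D_w F x) (G x) + dotprod (F x) ('D_w G x).
Proof.
move=> dF dG; rewrite (_ : (fun _ => _) =
    \sum_i ((fun y => F y 0 i) * (fun y => G y 0 i))); last first.
  by apply/funext => y; rewrite fct_sumE.
have dFi i : derivable (fun y => F y 0 i) x w.
  by apply: diff_derivable; exact: differentiable_coordE.
have dGi i : derivable (fun y => G y 0 i) x w.
  by apply: diff_derivable; exact: differentiable_coordE.
rewrite derive_sum => [|i]; last exact: derivableM.
rewrite -big_split; apply: eq_bigr => i _.
rewrite (deriveM (dFi i) (dGi i)) !derive_coord//= addrC.
by congr (_ + _); exact: mulrC.
Qed.

Lemma differentiable_dotprodl m (F : 'rV[R]_n -> 'rV[R]_m) x (u : 'rV[R]_m) :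
  differentiable F x -> differentiable (fun y => dotprod (F y) u) x.
Proof. by move=> dF; exact: differentiable_dotprod. Qed.

Lemma derive_dotprodl m (F : 'rV[R]_n -> 'rV[R]_m) x w (u : 'rV[R]_m) :
  differentiable F x ->
  'D_w (fun y => dotprod (F y) u) x = dotprod ('D_w F x) u.
Proof.
move=> dF; rewrite derive_dotprod// derive_cst [X in _ + X]dotprodC.
by rewrite [dotprod 0 _]dotprodE mul0mx mxE addr0.
Qed.

(** The mean value theorem, applied to the difference [phi] of [f] along two parallel segments in
    direction [v], reduces the mixed difference to an increment of [q], the derivative of [f] along
    [v]. The first-order expansion of [q] at [x] then gives the Hessian term. *)
Lemma second_difference f x u v (e : R) : 0 < e ->
  (\forall y \near x, differentiable f y) -> differentiable (gradient f) x ->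
  exists2 d : R, 0 < d & forall t, 0 < t < d ->
    `|f (x + t *: u + t *: v) - f (x + t *: u) - f (x + t *: v) + f x
      - t ^+ 2 * dotprod (u *m 'J (gradient f) x) v| <= e * t ^+ 2.
Proof.
move=> e0 fd gd; pose q y := dotprod (gradient f y) v.
pose B w := dotprod (w *m 'J (gradient f) x) v.
have qd : differentiable q x by exact: differentiable_dotprodl.
(* All displacements from [x] used below have norm at most [t * K]. With [e1 = e / (2 K)], the two
   expansion errors, each at most [e1 * (t * K)], add up to [e * t]. *)
pose K := `|u| + `|v| + 1.
have K0 : 0 < K by rewrite ltr_wpDl// addr_ge0.
pose e1 := e / (2 * K).
have e10 : 0 < e1 by rewrite divr_gt0// mulr_gt0.
have qB : \forall h \near (0 : 'rV[R]_n), `|q (x + h) - q x - B h| <= e1 * `|h|.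
  have /diff_locallyP[_ /eqaddoP/(_ e1 e10)] := qd.
  apply: filterS => h; rewrite !fctE /= -[X in _ - (_ + X)]deriveE//.
  by rewrite derive_dotprodl// deriveEjacobian// opprD addrA (addrC h).
have fdh : \forall h \near (0 : 'rV[R]_n), differentiable f (x + h).
  by move: fd; rewrite (near_shift 0) subr0; apply: filterS => h /=; rewrite addrC.
have /nbhs_ballP[d /= d0 hd] : \forall h \near (0 : 'rV[R]_n),
    `|q (x + h) - q x - B h| <= e1 * `|h| /\ differentiable f (x + h).
  by apply: filterS2 qB fdh => h.
have {}hd h : `|h| < d ->
    `|q (x + h) - q x - B h| <= e1 * `|h| /\ differentiable f (x + h).
  by move=> hd'; apply: hd; rewrite -ball_normE /= sub0r normrN.
exists (d / K) => [|t /andP[t0 td]]; first exact: divr_gt0.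
have tK : t * K < d by rewrite -ltr_pdivlMr.
have small1 s : 0 <= s <= t -> `|s *: v| <= t * K.
  move=> /andP[s0 st]; rewrite normrZ ger0_norm//.
  by apply: ler_pM => //; rewrite /K; have := normr_ge0 u; lra.
have small2 s : 0 <= s <= t -> `|t *: u + s *: v| <= t * K.
  move=> /andP[s0 st]; rewrite (le_trans (ler_normD _ _))// !normrZ.
  rewrite !ger0_norm//; last exact: ltW.
  rewrite /K !mulrDr -addrA lerD2l ler_wpDr//; first by rewrite mulr1 ltW.
  exact: ler_wpM2r.
pose phi s := f (x + t *: u + s *: v) - f (x + s *: v).
have dphi s : 0 <= s <= t -> is_derive s 1 phi (q (x + t *: u + s *: v) - q (x + s *: v)).
  move=> st; apply: is_deriveB.
    have df : differentiable f (x + t *: u + s *: v).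
      by rewrite -addrA; apply: (hd _ _).2; rewrite (le_lt_trans (small2 _ st)).
    by rewrite /q dotprodC -derive_gradient//; exact: is_derive_line.
  have df : differentiable f (x + s *: v).
    by apply: (hd _ _).2; rewrite (le_lt_trans (small1 _ st)).
  by rewrite /q dotprodC -derive_gradient//; exact: is_derive_line.
have [c ct phiE] : exists2 c, c \in `]0, t[%R & phi t - phi 0 = 
    (q (x + t *: u + c *: v) - q (x + c *: v)) * (t - 0).
  apply: (@MVT R phi (fun s => q (x + t *: u + s *: v) - q (x + s *: v))) => //.
    by move=> s /itvP st; apply: dphi; rewrite !st.
  apply: derivable_within_continuous => s /itvP st.
  by case: (dphi s); rewrite ?st.
have {}ct : 0 <= c <= t by move/itvP: ct => ct; rewrite !ct.
have [h1 _] := hd _ (le_lt_trans (small1 _ ct) tK).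
have [h2 _] := hd _ (le_lt_trans (small2 _ ct) tK).
(* By linearity the unknown intermediate point [c] drops out of the main term. *)
have BE : B (t *: u + c *: v) - B (c *: v) = t * B u.
  by rewrite /B mulmxDl dotprodDl -!scalemxAl !dotprodZl addrK.
have -> : f (x + t *: u + t *: v) - f (x + t *: u) - f (x + t *: v) + f x
     - t ^+ 2 * dotprod (u *m 'J (gradient f) x) v =
     t * ((q (x + (t *: u + c *: v)) - q x - B (t *: u + c *: v)) -
          (q (x + c *: v) - q x - B (c *: v))).
  move: phiE; rewrite /phi !scale0r !addr0 subr0 -/(B u) -!(addrA x).
  have -> : B (t *: u + c *: v) = t * B u + B (c *: v) by rewrite -BE subrK.
  by move=> E; lra.
rewrite normrM gtr0_norm// expr2 mulrA [e * t]mulrC -mulrA ler_pM2l//.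
rewrite (le_trans (ler_normB _ _))//.
have : e * t = e1 * (t * K) + e1 * (t * K).
  rewrite /e1; field; exact: lt0r_neq0.
move=> ->; apply: lerD.
  by apply: (le_trans h2); rewrite ler_pM2l//; exact: small2.
by apply: (le_trans h1); rewrite ler_pM2l//; exact: small1.
Qed.

(** The mixed second difference is unchanged when [u] and [v] are exchanged, so for small [t] both
    values of the Hessian form, multiplied by [t ^+ 2], lie within [e / 2 * t ^+ 2] of the same
    number. *)
Lemma hessian_sym f x :
  (\forall y \near x, differentiable f y) -> differentiable (gradient f) x ->
  ('J (gradient f) x)^T = 'J (gradient f) x.
Proof.
move=> fd gd; set H := 'J (gradient f) x.
suff Huv u v : dotprod (u *m H) v = dotprod (v *m H) u.
  apply/matrixP => i j; have := Huv (delta_mx 0 i) (delta_mx 0 j).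
  by rewrite -!rowE !dotprod_delta !mxE.
apply/eqP; rewrite -subr_eq0 -normr_le0; apply/ler_addgt0Pr => e e0; rewrite add0r.
have e20 : 0 < e / 2 by rewrite divr_gt0.
have [d1 d10 h1] := second_difference u v e20 fd gd.
have [d2 d20 h2] := second_difference v u e20 fd gd.
pose t := Num.min d1 d2 / 2.
have m0 : 0 < Num.min d1 d2 by rewrite lt_min d10.
have t0 : 0 < t by rewrite divr_gt0.
have tm : t < Num.min d1 d2 by rewrite /t; lra.
have [td1 td2] : t < d1 /\ t < d2 by move: tm; rewrite lt_min => /andP[].
have {}h1 := h1 t; have {}h2 := h2 t; rewrite t0 td1 td2 in h1 h2.
have {}h1 := h1 isT; have {}h2 := h2 isT.
rewrite -(ler_pM2l (exprn_gt0 2 t0)).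
rewrite -[X in X * `|_|]gtr0_norm ?exprn_gt0// -normrM mulrBr.
rewrite (addrAC x (t *: v)) (addrAC (f _) (- f (x + t *: v))) in h2.
set F := _ + f x in h1; rewrite -/F in h2.
rewrite (_ : _ - _ = (F - t ^+ 2 * dotprod (v *m H) u) -
  (F - t ^+ 2 * dotprod (u *m H) v)); last by ring.
apply: (le_trans (ler_normB _ _)); rewrite [leRHS]mulrC [e]splitr mulrDl.
exact: lerD.
Qed.

End Line.

(** * Geometry of the graph *)

Lemma dotprod_row_mx (R : realType) n (u v : 'rV[R]_n) (a b : R) :
  dotprod (row_mx u a%:M) (row_mx v b%:M) = dotprod u v + a * b.
Proof.
rewrite !dotprodE tr_row_mx mul_row_col mxE tr_scalar_mx -scalar_mxM.
by rewrite [X in _ + X]mxE eqxx mulr1n.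
Qed.

Lemma is_derive_graph_map (R : realType) n (f : 'rV[R]_n -> R) x :
  differentiable f x ->
  differentiable (graph_map f) x /\
  forall v, 'D_v (graph_map f) x = row_mx v (dotprod v (gradient f x))%:M.
Proof.
move=> df.
have dg : differentiable (graph_map f) x.
  apply: differentiable_rV => i; case: (split_ordP i) => j ->.
    rewrite (_ : (fun _ => _) = (fun y : 'rV[R]_n => y 0 j)).
      exact: differentiable_coord.
    by apply/funext => y; rewrite /graph_map row_mxEl.
  rewrite (_ : (fun _ => _) = f) //.
  by apply/funext => y; rewrite /graph_map row_mxEr mxE (ord1 j) eqxx.
split=> // v; apply/rowP => i.
rewrite derive_mx; last exact: diff_derivable.
rewrite mxE; case: (split_ordP i) => j ->.
  rewrite row_mxEl (_ : (fun _ => _) = (fun y : 'rV[R]_n => y 0 j)); last first.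
    by apply/funext => y; rewrite /graph_map row_mxEl.
  by have := @derive_coord _ _ _ id x v j; rewrite derive_id => ->.
rewrite row_mxEr mxE (ord1 j) eqxx -derive_gradient//; congr ('D_v _ x).
by apply/funext => y; rewrite /graph_map row_mxEr mxE eqxx.
Qed.

Section UnitNormal.
Context {R : realType} {n : nat} (U : set 'rV[R]_n) (f : 'rV[R]_n -> R)
  (N : 'rV[R]_n -> 'rV[R]_(n + 1)).
Hypotheses (hU : open U) (hf : C2_on U f) (hN : unit_normal_field U f N).

(** This is the factor [nu] in the overview. Its sign is only locally constant on [U], which may be
    disconnected. *)
Definition normal_height (x : 'rV[R]_n) : R := N x 0 (rshift n 0).

Local Notation nu := normal_height.
Local Notation p := (gradient f).
Local Notation H := (jacobian (gradient f)).

Lemma rsubmx_unit_normal x : rsubmx (N x) = (nu x)%:M.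
Proof. by apply/rowP => j; rewrite !mxE (ord1 j). Qed.

(** Orthogonality to the tangent vector over the [i]-th basis vector says that the [i]-th coordinate
    of [N x] is [- nu x] times the [i]-th partial derivative of [f]. *)
Lemma unit_normalE x : U x -> N x = nu x *: row_mx (- p x) 1%:M.
Proof.
move=> Ux; have [df _ _] := hf Ux; have [_ _ No] := hN Ux.
rewrite -[LHS]hsubmxK rsubmx_unit_normal.
suff -> : lsubmx (N x) = - (nu x *: p x).
  by rewrite scale_row_mx scalerN scale_scalar_mx mulr1.
apply/rowP => i; have := No (delta_mx 0 i).
rewrite (is_derive_graph_map df).2 -[N x]hsubmxK rsubmx_unit_normal.
rewrite dotprod_row_mx dotprod_delta dotprodC dotprod_delta row_mxKl.
by move/eqP; rewrite addr_eq0 => /eqP->; rewrite !mxE.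
Qed.

Lemma normal_height_sqr x : U x -> nu x ^+ 2 * (1 + dotprod (p x) (p x)) = 1.
Proof.
move=> Ux; have [_ N1 _] := hN Ux.
have /(congr1 (fun z => z ^+ 2)) := N1.
rewrite sqr_sqrtr ?dotprod_ge0// expr1n (unit_normalE Ux) => e; rewrite -[RHS]e.
by rewrite dotprodZl dotprodZr dotprod_row_mx dotprodNl dotprodNr; ring.
Qed.

Lemma normal_height_neq0 x : U x -> nu x != 0.
Proof.
move=> /normal_height_sqr e; apply/eqP => n0.
by move: e; rewrite n0 expr0n mul0r => /esym/eqP; rewrite oner_eq0.
Qed.

Lemma normal_height_continuous x : U x -> {for x, continuous nu}.
Proof.
move=> Ux; have [cN _ _] := hN Ux.
apply: (@continuous_comp _ _ _ N (fun M : 'rV[R]_(n + 1) => M 0 (rshift n 0))) => //.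
exact: coord_continuous.
Qed.

Lemma near_domain x : U x -> \forall y \near x, U y.
Proof. by move=> Ux; exact: open_nbhs_nbhs. Qed.

(** The field [N] is only assumed continuous. But [nu] equals its sign times [w], the inverse of
    [sqrt (1 + |grad f|^2)]; being continuous and nonzero, it has constant sign near [x], and there
    it inherits the differentiability of [w]. *)
Lemma differentiable_normal_height x : U x -> differentiable nu x.
Proof.
move=> Ux; have [_ dp _] := hf Ux.
pose w y := (Num.sqrt (1 + dotprod (p y) (p y)))^-1.
have w0 y : 0 < 1 + dotprod (p y) (p y) by rewrite ltr_wpDr// dotprod_ge0.
have nuw y : U y -> nu y = Num.sg (nu y) * w y.
  move=> Uy; rewrite -[LHS]mulr_sg_norm; congr (_ * _).
  apply/eqP; rewrite -(@eqrXn2 _ 2)// ?invr_ge0 ?sqrtr_ge0// exprVn sqr_sqrtr ?ltW//.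
  rewrite real_normK ?num_real//; apply/eqP/(mulIf (lt0r_neq0 (w0 y))).
  by rewrite (normal_height_sqr Uy) mulVf ?lt0r_neq0.
apply: (@near_eq_differentiable _ _ _ (Num.sg (nu x) *: w)).
  have sgc : \forall y \near x, Num.sg (nu y) = Num.sg (nu x).
    have cnu := normal_height_continuous Ux.
    case: (ltgtP (nu x) 0) (normal_height_neq0 Ux) => // nux _.
      have : \forall y \near x, nu y < 0 by exact: (cvgr_lt _ cnu).
      by apply: filterS => y ny; rewrite !ltr0_sg.
    have : \forall y \near x, 0 < nu y by exact: (cvgr_gt _ cnu).
    by apply: filterS => y ny; rewrite !gtr0_sg.
  by apply: filterS2 sgc (near_domain Ux) => y sy Uy; rewrite [RHS]nuw// sy.
apply: differentiableZ.
apply: (@differentiableV _ _ (fun y => Num.sqrt (1 + dotprod (p y) (p y)))).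
  2: by rewrite gt_eqF// sqrtr_gt0.
apply: (@differentiable_comp _ _ _ _ (fun y => 1 + dotprod (p y) (p y)) Num.sqrt).
  by apply: differentiableD => //; exact: differentiable_dotprod.
by apply/derivable1_diffP; have [] := is_derive1_sqrt (w0 x).
Qed.

Lemma differentiable_unit_normal x : U x -> differentiable N x.
Proof.
move=> Ux; have [_ dp _] := hf Ux; have dnu := differentiable_normal_height Ux.
apply: (@near_eq_differentiable _ _ _ (fun y => nu y *: row_mx (- p y) 1%:M)).
  by apply: filterS (near_domain Ux) => y Uy; rewrite -unit_normalE.
apply: differentiable_rV => i; case: (split_ordP i) => j ->.
  rewrite (_ : (fun _ => _) = - (nu * (fun y => p y 0 j))); last first.
    by apply/funext => y; rewrite mxE row_mxEl mxE mulrN.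
  by apply/differentiableN/differentiableM => //; exact: differentiable_coordE.
rewrite (_ : (fun _ => _) = nu)//.
by apply/funext => y; rewrite mxE row_mxEr mxE (ord1 j) eqxx mulr1.
Qed.

Lemma rsubmx_derive_unit_normal x v : U x ->
  rsubmx ('D_v N x) = ('D_v nu x)%:M.
Proof.
move=> Ux; apply/rowP => j; rewrite mxE -derive_coord ?mxE ?(ord1 j)//.
exact: differentiable_unit_normal.
Qed.

(** Differentiating [|N|^2 = 1] shows that ['D_v N x] is orthogonal to [N x = nu (- grad f, 1)];
    divide by [nu]. In other words, ['D_v N x] is tangent to the graph. *)
Lemma derive_normal_height x v : U x ->
  'D_v nu x = dotprod (lsubmx ('D_v N x)) (p x).
Proof.
move=> Ux; have dN := differentiable_unit_normal Ux.
have dnuE := rsubmx_derive_unit_normal v Ux.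
have : 'D_v (fun y => dotprod (N y) (N y)) x = 0.
  rewrite (@near_eq_derive _ _ _ _ (cst (1 : R))) ?derive_cst//.
  apply: filterS (near_domain Ux) => y Uy; have [_ + _] := hN Uy.
  by move=> /(congr1 (fun z => z ^+ 2)); rewrite sqr_sqrtr ?dotprod_ge0// expr1n.
rewrite derive_dotprod// (dotprodC (N x)) (unit_normalE Ux) -mulr2n.
rewrite -[in dotprod _ _](hsubmxK ('D_v N x)) dnuE.
rewrite dotprodZr dotprod_row_mx mulr1 dotprodNr.
move/eqP; rewrite mulrn_eq0/= mulf_eq0 (negPf (normal_height_neq0 Ux))/=.
by rewrite addrC subr_eq0 => /eqP.
Qed.

Lemma lsubmx_derive_unit_normal x v : U x ->
  lsubmx ('D_v N x) = - ('D_v nu x *: p x) - nu x *: (v *m H x).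
Proof.
move=> Ux; have [_ dp _] := hf Ux.
have dN := differentiable_unit_normal Ux; have dnu := differentiable_normal_height Ux.
apply/rowP => j; rewrite mxE -derive_coord//.
rewrite (@near_eq_derive _ _ _ _ (- (nu * (fun y => p y 0 j)))); last first.
  apply: filterS (near_domain Ux) => y Uy.
  by rewrite /= (unit_normalE Uy) mxE row_mxEl mxE mulrN.
have dpj : derivable (fun y => p y 0 j) x v.
  by apply: diff_derivable; exact: differentiable_coordE.
have dnu' : derivable nu x v by exact: diff_derivable.
rewrite (deriveN (derivableM dnu' dpj)) (deriveM dnu' dpj).
rewrite derive_coord// deriveEjacobian// !mxE.
by rewrite opprD addrC; congr (- _ - _); exact: mulrC.
Qed.

Definition gram (x : 'rV[R]_n) : 'M[R]_n := 1%:M + (p x)^T *m p x.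

Lemma mul_gram x v : v *m gram x = v + dotprod v (p x) *: p x.
Proof.
rewrite mulmxDr mulmx1 mulmxA [v *m _]mx11_scalar mul_scalar_mx.
by rewrite -dotprodE.
Qed.

(** The derivatives of [N] are tangent, so ['J N x] factors through ['J (graph_map f) x] with
    coefficients its first [n] columns. The latter Jacobian starts with an identity block, so it is
    row free and its pseudo-inverse cancels it. *)
Lemma shape_operatorE x : U x -> shape_operator f N x = - lsubmx ('J N x).
Proof.
move=> Ux; have [df _ _] := hf Ux.
have [dg gE] := is_derive_graph_map df; have dN := differentiable_unit_normal Ux.
rewrite /shape_operator; suff -> : - 'J N x = - lsubmx ('J N x) *m 'J (graph_map f) x.
  apply: mulmxKp; apply/row_freeP; exists (col_mx 1%:M 0).
  apply/row_matrixP => i; rewrite !rowE mulmxA -deriveEjacobian// gE mul_row_col.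
  by rewrite mulmx1 mulmx0 addr0.
apply/row_matrixP => i; rewrite !rowE mulmxA -deriveEjacobian// gE.
set v := delta_mx 0 i.
have vN : v *m lsubmx ('J N x) = lsubmx ('D_v N x).
  by rewrite deriveEjacobian// -{2}['J N x]hsubmxK mul_mx_row row_mxKl.
rewrite !mulmxN vN dotprodNl -derive_normal_height// -deriveEjacobian//.
rewrite -[in LHS](hsubmxK ('D_v N x)) rsubmx_derive_unit_normal//.
by rewrite opp_row_mx -[X in row_mx _ X]raddfN.
Qed.

(** On a vector [v], put [w = lsubmx ('D_v N x)]. Then [w *m gram x] is [w] plus ['D_v nu x] times
    the gradient, which cancels the gradient term of [w] and leaves only the Hessian. *)
Lemma shape_operator_gram x : U x ->
  shape_operator f N x *m gram x = nu x *: H x.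
Proof.
move=> Ux; have dN := differentiable_unit_normal Ux.
rewrite shape_operatorE//; apply/row_matrixP => i; rewrite !rowE mulmxA.
set v := delta_mx 0 i.
have vN : v *m lsubmx ('J N x) = lsubmx ('D_v N x).
  by rewrite deriveEjacobian// -{2}['J N x]hsubmxK mul_mx_row row_mxKl.
rewrite mulmxN vN mulNmx mul_gram -derive_normal_height//.
by rewrite lsubmx_derive_unit_normal// -scalemxAr addrAC addNr sub0r opprK.
Qed.

End UnitNormal.

(** * Tangency with a hemisphere *)

Lemma derive_quotient (R : realType) (g : R -> R) (l e : R) :
  is_derive (0 : R) 1 g l -> 0 < e ->
  exists2 d : R, 0 < d & forall h, 0 < h < d -> `|(g h - g 0) / h - l| < e.
Proof.
move=> [dg gl] e0.
have /cvgrPdist_lt/(_ e e0) : h^-1 *: (g (h *: 1 + 0) - g 0) @[h --> 0^'] --> l.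
  by rewrite -gl.
move=> /nbhs_ballP[d /= d0 hd]; exists d => // h /andP[h0 hd'].
have := hd h; rewrite /ball/= sub0r normrN gtr0_norm// => /(_ hd').
rewrite gt_eqF// => /(_ isT).
by rewrite distrC addr0 /GRing.scale/= mulr1 mulrC.
Qed.

(** If [d] were negative, [g'] would be negative just to the right of [0], and the mean value
    theorem would give [g t < g 0] for a small [t > 0]. *)
Lemma second_derive_min (R : realType) (g g' : R -> R) (d : R) :
  (\forall t \near (0 : R), is_derive t (1 : R) g (g' t)) -> is_derive (0 : R) 1 g' d ->
  (\forall t \near (0 : R), g 0 <= g t) -> g' 0 = 0 /\ 0 <= d.
Proof.
move=> dg dg' gmin.
have : \forall t \near (0 : R), is_derive t (1 : R) g (g' t) /\ g 0 <= g t.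
  exact: filterI.
move=> /nbhs_ballP[e /= e0 he].
have {}he t : - e < t < e -> is_derive t (1 : R) g (g' t) /\ g 0 <= g t.
  by move=> te; apply: he; rewrite /ball/= sub0r normrN ltr_norml.
have g'0 : g' 0 = 0.
  have g0 : is_derive (0 : R) 1 g 0.
    apply: (@derive1_at_min _ g (- e) e 0) => [|t|| t]; rewrite ?in_itv/=.
    - by rewrite lerNl; lra.
    - by move=> /he[[]].
    - by rewrite oppr_lt0 e0.
    - by move=> /he[].
  have [[_ <-] _] := he 0 ltac:(by rewrite oppr_lt0 e0).
  by rewrite derive_val.
split => //; rewrite leNgt; apply/negP => d0.
(* With tolerance [- d] the difference quotient of [g'] at [0] stays negative. *)
have [d1 d10 hd1] := derive_quotient dg' (ltac:(lra) : 0 < - d).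
pose t := Num.min d1 e / 2.
have m0 : 0 < Num.min d1 e by rewrite lt_min d10.
have t0 : 0 < t by rewrite divr_gt0.
have tm : t < Num.min d1 e by rewrite /t; lra.
have [td1 te] : t < d1 /\ t < e by move: tm; rewrite lt_min => /andP[].
have [c ct gE] : exists2 c, c \in `]0, t[%R & g t - g 0 = g' c * (t - 0).
  apply: MVT => //.
    move=> s /itvP st; apply: (he s _).1.
    by rewrite (lt_trans _ (_ : 0 < s)) ?st ?oppr_lt0// (lt_trans _ te) ?st.
  apply: derivable_within_continuous => s /itvP st.
  have [|[]//] := he s.
  by rewrite (lt_le_trans _ (_ : 0 <= s)) ?st ?oppr_lt0// (le_lt_trans _ te) ?st.
move/itvP: ct => ct.
have c0 : 0 < c by rewrite ct.
have [_] := he t ltac:(by rewrite te (lt_trans _ t0) ?oppr_lt0).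
rewrite -subr_ge0 gE subr0 pmulr_lge0// leNgt => /negP; apply.
have := hd1 c; rewrite c0 (lt_trans _ td1) ?ct// => /(_ isT).
rewrite g'0 subr0 => /(le_lt_trans (ler_norm _)).
by rewrite ltrBlDr addNr pmulr_llt0// invr_gt0.
Qed.

Section Touching.
Context {R : realType} {n : nat} (c : 'rV[R]_n) (r : R).
Hypothesis r0 : 0 < r.

Lemma eclosed_ballE : eclosed_ball c r = [set x | dotprod (x - c) (x - c) <= r ^+ 2].
Proof.
apply/seteqP; split => x /=; rewrite /eclosed_ball/= /enorm => h.
  by rewrite -(sqr_sqrtr (dotprod_ge0 _)) lerXn2r// nnegrE ?sqrtr_ge0// ltW.
by rewrite -(ler_pXn2r (n := 2))// ?nnegrE ?sqrtr_ge0// ?(ltW r0)// sqr_sqrtr ?dotprod_ge0.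
Qed.

Lemma differentiable_sqdist x : differentiable (fun y => dotprod (y - c) (y - c)) x.
Proof. by apply: differentiable_dotprod; apply: differentiableB. Qed.

Lemma compact_eclosed_ball : compact (eclosed_ball c r).
Proof.
apply: bounded_closed_compact; rewrite eclosed_ballE.
  exists (`|c| + r); split; first exact: num_real.
  move=> M cM x /= xr; apply: ltW; apply: le_lt_trans cM.
  rewrite -[x](subrK c) addrC (le_trans (ler_normD _ _))// lerD2l.
  rewrite [leLHS]mx_normrE; apply: bigmax_le => [|[i j] _]; first exact: ltW.
  rewrite /= ord1 -(ler_pXn2r (n := 2))// ?nnegrE ?(ltW r0)// real_normK ?num_real//.
  apply: le_trans xr; rewrite /dotprod (bigD1 j)//= -expr2 lerDl.
  by apply: sumr_ge0 => k _; rewrite -expr2 sqr_ge0.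
have /continuous_closedP/(_ [set z | z <= r ^+ 2]) :
    continuous (fun y : 'rV[R]_n => dotprod (y - c) (y - c)).
  by move=> x; apply: differentiable_continuous; exact: differentiable_sqdist.
by apply; exact: closed_le.
Qed.

(** The point [x] maximizes [g], so over the ball the graph of [s f] lies below the lower hemisphere
    of radius [r] centred at [(c, g x)] and touches it over [x]; [m] is the depth of the contact
    point below the centre. The equation for [m] is the first-order condition, the inequality the
    second-order one. *)
Lemma touching_hemisphere (U : set 'rV[R]_n) (f : 'rV[R]_n -> R) (s : R) :
  open U -> eclosed_ball c r `<=` U -> C2_on U f ->
  exists x m, [/\ eclosed_ball c r x, 0 < m,
    m ^+ 2 * (1 + s ^+ 2 * dotprod (gradient f x) (gradient f x)) = r ^+ 2 &
    forall v, m * (s * dotprod (v *m 'J (gradient f) x) v) <=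
      dotprod v v + s ^+ 2 * dotprod v (gradient f x) ^+ 2].
Proof.
move=> Uo BU hf.
pose q y := dotprod (y - c) (y - c).
have dq y : differentiable q y by exact: differentiable_sqdist.
have df y : U y -> differentiable f y by case/hf.
have Bq y : eclosed_ball c r y <-> q y <= r ^+ 2 by rewrite eclosed_ballE.
pose g y := s * f y + Num.sqrt (r ^+ 2 - q y).
have [x /set_mem Bx xmax] : exists2 x, x \in eclosed_ball c r &
    forall y, y \in eclosed_ball c r -> g y <= g x.
  apply: compact_EVT_max.
  - exists c; apply/Bq; rewrite /q subrr dotprodE mul0mx mxE; exact: sqr_ge0.
  - exact: compact_eclosed_ball.
  - apply: continuous_in_subspaceT => y /set_mem/BU/df dfy.
    apply: (@continuousD _ _ _ (fun y => s * f y) (fun y => Num.sqrt (r ^+ 2 - q y))).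
      apply: differentiable_continuous.
      exact: (@differentiableZ _ _ _ f s y dfy).
    apply: (@continuous_comp _ _ _ (fun y => r ^+ 2 - q y) Num.sqrt).
      by apply: differentiable_continuous; exact: (@differentiableB _ _ _ (cst _) q).
    exact: sqrt_continuous.
have Ux := BU _ Bx.
(* Here [m y] is the depth of [(y, s f y)] below the centre [(c, g x)]. The next two facts say that
   the graph of [s f] stays outside the open ball of radius [r] about this centre and meets its
   boundary over [x]. *)
pose m y := g x - s * f y.
have mge y : eclosed_ball c r y -> 0 <= m y /\ r ^+ 2 <= m y ^+ 2 + q y.
  move=> By; have := xmax _ (mem_set By); rewrite {1}/g -lerBrDl -/(m y) => h.
  have m0 : 0 <= m y by apply: le_trans h; exact: sqrtr_ge0.
  split=> //; rewrite -lerBlDr -[leLHS]sqr_sqrtr ?subr_ge0; last exact/Bq.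
  by rewrite lerXn2r// nnegrE sqrtr_ge0.
have mx : m x ^+ 2 + q x = r ^+ 2.
  by rewrite /m /g addrAC subrr add0r sqr_sqrtr ?subrK// subr_ge0; exact/Bq.
have dline (h : 'rV[R]_n -> R) y v t : differentiable h (y + t *: v) ->
    is_derive t (1 : R) (fun t => h (y + t *: v)) ('D_v h (y + t *: v)).
  exact: is_derive_line.
have m0 : 0 < m x.
  rewrite lt_neqAle (mge x Bx).1 andbT; apply/negP => /eqP m0.
  have qx : q x = r ^+ 2 by rewrite -mx -m0 expr0n add0r.
  (* At a boundary maximum, moving inward by t v forces m ^+ 2 >= (2 t - t ^+ 2) r ^+ 2,
     whereas m, vanishing at x and differentiable there, is O(t). *)
  pose v := c - x.
  have qv t : q (x + t *: v) = (1 - t) ^+ 2 * r ^+ 2.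
    rewrite -qx /q (_ : x + t *: v - c = (1 - t) *: (x - c)).
      by rewrite dotprodZl dotprodZr mulrA.
    by rewrite /v -(opprB x c) scalerN scalerBl scale1r addrAC.
  have df0 : differentiable f (x + 0 *: v) by rewrite scale0r addr0; exact: df.
  have := dline f x v 0 df0; set l := 'D_v f _ => dl.
  have [d d0 hd] := derive_quotient dl ltr01.
  (* For [t < d] the difference quotient of [f] is within [1] of [l], so [m ^+ 2] is at most
     [K * t ^+ 2] at the shifted point. The bound [t < 1] keeps that point in the ball, and together
     with [t < r ^+ 2 / (K + 1)] it yields [K * t ^+ 2 + (1 - t) ^+ 2 * r ^+ 2 < r ^+ 2], the
     contradiction. *)
  pose K := s ^+ 2 * (`|l| + 1) ^+ 2.
  have K0 : 0 <= K by rewrite mulr_ge0 ?sqr_ge0.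
  pose t := Num.min (Num.min d 1) (r ^+ 2 / (K + 1)) / 2.
  have r20 : 0 < r ^+ 2 by rewrite exprn_gt0.
  have min0 : 0 < Num.min (Num.min d 1) (r ^+ 2 / (K + 1)).
    by rewrite !lt_min d0 ltr01 divr_gt0// ltr_wpDl.
  have t0 : 0 < t by rewrite divr_gt0.
  have : t < Num.min (Num.min d 1) (r ^+ 2 / (K + 1)) by rewrite /t; lra.
  rewrite !lt_min -andbA => /and3P[td t1 tK].
  have Bt : eclosed_ball c r (x + t *: v).
    apply/Bq; rewrite qv ler_piMl ?sqr_ge0//.
    by rewrite expr_le1 ?subr_ge0 ?(ltW t1)// gerBl ltW.
  have [_] := mge _ Bt; rewrite qv; apply/negP; rewrite -ltNge.
  have mt : m (x + t *: v) = s * (f x - f (x + t *: v)).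
    by have := m0; rewrite /m; lra.
  have := hd t; rewrite t0 td => /(_ isT); rewrite scale0r addr0.
  set D := f (x + t *: v) - f x => hD.
  have Dt : D ^+ 2 <= (`|l| + 1) ^+ 2 * t ^+ 2.
    rewrite -ler_pdivrMr ?exprn_gt0// -expr_div_n -real_normK ?num_real//.
    rewrite lerXn2r ?nnegrE ?addr_ge0// -(subrK l (D / t)).
    by rewrite (le_trans (ler_normD _ _))// addrC lerD2l ltW.
  rewrite mt -opprB -/D mulrN sqrrN exprMn.
  have {}Dt : s ^+ 2 * D ^+ 2 <= K * t ^+ 2.
    by rewrite /K -mulrA ler_wpM2l ?sqr_ge0.
  have {}tK : t * (K + 1) < r ^+ 2 by rewrite -ltr_pdivlMr// ltr_wpDl.
  have : t * (t * (K + 1)) < t * r ^+ 2 by rewrite ltr_pM2l.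
  have : 0 < t ^+ 2 by rewrite exprn_gt0.
  have : t ^+ 2 * r ^+ 2 < t * r ^+ 2 by rewrite ltr_pM2r// expr2 gtr_pMl.
  by nra.
have Bint : \forall y \near x, eclosed_ball c r y.
  have : q x < r ^+ 2 by rewrite -mx ltrDr exprn_gt0.
  move=> qx; have := differentiable_continuous (dq x) => qc.
  have : \forall y \near x, q y < r ^+ 2 by exact: (cvgr_lt _ qc).
  by apply: filterS => y /ltW qy; exact/Bq.
have Dq y v : 'D_v q y = 2 * dotprod v (y - c).
  rewrite /q derive_dotprod//; try exact: differentiableB.
  by rewrite deriveB// derive_id derive_cst subr0 dotprodC mulr_natl mulr2n.
exists x, (m x).
have dm y : U y -> differentiable m y.
  move=> /df dfy; apply: (@differentiableB _ _ _ (cst (g x)) (s *: f)) => //.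
  exact: differentiableZ.
have Dm y v : U y -> 'D_v m y = - (s * dotprod v (gradient f y)).
  move=> /df dfy; rewrite (_ : m = cst (g x) - s *: f)//.
  have dfv : derivable f y v by exact: diff_derivable.
  rewrite (deriveB (derivable_cst _ _ _) (derivableZ dfv)).
  by rewrite derive_cst sub0r (deriveZ _ dfv) derive_gradient.
have H v : - (m x * (s * dotprod v (gradient f x))) + dotprod v (x - c) = 0 /\
  m x * (s * dotprod (v *m 'J (gradient f) x) v) <=
      dotprod v v + s ^+ 2 * dotprod v (gradient f x) ^+ 2.
  have [_ dp _] := hf x Ux.
  have near_line (A : set 'rV[R]_n) : nbhs x A -> \forall t \near (0 : R), A (x + t *: v).
    have : (fun t : R => x + t *: v) t @[t --> (0 : R)] --> x.
      rewrite -[X in _ --> X]addr0 -(scale0r v).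
      by apply: cvgD; [exact: cvg_cst|apply: cvgZr_tmp].
    exact.
  (* The squared distance from the graph to the centre of the hemisphere has a local
     minimum at x; unlike g, it is differentiated without a square root. *)
  pose M := m * m + q.
  pose a y := dotprod v (gradient f y).
  (* On [U], [P] is the derivative of [M] along [v], in a form that can be differentiated once more
     at [x]. *)
  pose P := - (2 * s) *: (m * a) + 2 *: (fun y => dotprod v (y - c)).
  have dM y : U y -> differentiable M y.
    move=> Uy; have dmy := dm y Uy.
    exact: (@differentiableD _ _ _ (m * m) q y
      (@differentiableM _ _ m m y dmy dmy) (dq y)).
  have DM y : U y -> 'D_v M y = P y.
    move=> Uy; have dmv : derivable m y v by apply: diff_derivable; exact: dm.
    have dqv : derivable q y v by exact: diff_derivable.
    rewrite (deriveD (derivableM dmv dmv) dqv) (deriveM dmv dmv) (Dm y v Uy) Dq.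
    by rewrite /P /a !fctE /GRing.scale/=; ring.
  have da : differentiable a x by exact: differentiable_dotprod.
  have dvc : differentiable (fun y => dotprod v (y - c)) x.
    by apply: differentiable_dotprod => //; exact: differentiableB.
  have dP : differentiable P x.
    have dma : differentiable (m * a) x := @differentiableM _ _ m a x (dm x Ux) da.
    exact: (@differentiableD _ _ _ (- (2 * s) *: (m * a))
      (2 *: (fun y => dotprod v (y - c))) x
      (@differentiableZ _ _ _ _ _ _ dma) (@differentiableZ _ _ _ _ _ _ dvc)).
  have DP : 'D_v P x = 2 * (dotprod v v + s ^+ 2 * a x ^+ 2 -
      m x * (s * dotprod (v *m 'J (gradient f) x) v)).
    have dmv : derivable m x v by apply: diff_derivable; exact: dm.
    have dav : derivable a x v by exact: diff_derivable.
    have dvcv : derivable (fun y => dotprod v (y - c)) x v by exact: diff_derivable.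
    have Da : 'D_v a x = dotprod (v *m 'J (gradient f) x) v.
      rewrite /a derive_dotprod// derive_cst deriveEjacobian//.
      by rewrite [dotprod 0 _]dotprodE mul0mx mxE add0r dotprodC.
    have Dvc : 'D_v (fun y => dotprod v (y - c)) x = dotprod v v.
      have dyc : differentiable (fun y => y - c) x by exact: differentiableB.
      rewrite derive_dotprod// derive_cst deriveB// derive_id derive_cst subr0.
      by rewrite [dotprod 0 _]dotprodE mul0mx mxE add0r.
    have dmav : derivable (m * a) x v by exact: (derivableM dmv dav).
    have d1 : derivable (- (2 * s) *: (m * a)) x v by exact: (derivableZ dmav).
    have d2 : derivable (2 *: (fun y => dotprod v (y - c))) x v.
      exact: (derivableZ dvcv).
    rewrite (deriveD d1 d2) (deriveZ _ dmav) (deriveZ _ dvcv) (deriveM dmv dav).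
    by rewrite (Dm x v Ux) Da Dvc -/(a x) /GRing.scale/=; ring.
  have [|||] := @second_derive_min R (fun t => M (x + t *: v))
    (fun t => P (x + t *: v)) ('D_v P x).
  - have := near_line _ (open_nbhs_nbhs (conj Uo Ux)).
    apply: filterS => t Ut; have := dline M x v t (dM _ Ut).
    by rewrite (DM _ Ut).
  - by have := dline P x v 0; rewrite scale0r addr0 => /(_ dP).
  - have := near_line _ Bint; apply: filterS => t /mge[_]; rewrite scale0r addr0.
    by rewrite /M !fctE -expr2 mx expr2.
  rewrite scale0r addr0 DP pmulr_rge0// subr_ge0 -/(a x) => P0 ->; split => //.
  by move: P0; rewrite /P !fctE /GRing.scale/= -/(a x); lra.
split => //; last by move=> v; exact: (H v).2.
(* The first-order condition in every coordinate direction; inserted into [m x ^+ 2 + q x = r ^+ 2],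
   it gives the equation for [m]. *)
have E : x - c = (m x * s) *: gradient f x.
  apply/rowP => j; have := (H (delta_mx 0 j)).1.
  rewrite ![dotprod (delta_mx 0 j) _]dotprodC !dotprod_delta.
  by move=> /eqP; rewrite addrC subr_eq0 => /eqP ->; rewrite [RHS]mxE mulrA.
by rewrite -mx /q E dotprodZl dotprodZr; ring.
Qed.

End Touching.

(** * The curvature estimate *)

(** Sorting [k] shows that the set in [principal_curvatures] is nonempty, so the default of [xget]
    does not occur. The chosen tuple has the same product of linear factors as [k], hence is a
    permutation of it. *)
Lemma mean_curvatureE (R : realType) n (f : 'rV[R]_n -> R)
    (N : 'rV[R]_n -> 'rV[R]_(n + 1)) x (k : n.-tuple R) :
  char_poly (shape_operator f N x) = \prod_(a <- k) ('X - a%:P) ->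
  mean_curvature f N x = n%:R^-1 * \sum_(a <- k) a.
Proof.
move=> kE; congr (_ * _).
have [_ pE] : sorted <=%R (principal_curvatures f N x) /\
    char_poly (shape_operator f N x) =
    \prod_(a <- principal_curvatures f N x) ('X - a%:P).
  apply: (@xgetPex _ [tuple 0 | _ < n]
    [set k : n.-tuple R | sorted <=%R k /\
       char_poly (shape_operator f N x) = \prod_(a <- k) ('X - a%:P)]).
  exists [tuple of sort <=%R k]; split; first exact: (sort_sorted le_total).
  by rewrite kE; apply: perm_big; rewrite perm_sym perm_sort.
rewrite -(big_tuple _ _ _ xpredT id); apply: perm_big; apply: prod_XsubC_eq.
by rewrite -pE kE.
Qed.

(** The segment from [c] to [x] stays in the ball, and along it [nu] is continuous and never zero,
    so the intermediate value theorem forbids a change of sign. *)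
Lemma normal_height_sign (R : realType) n (U : set 'rV[R]_n) f N c (r : R) x : 0 < r ->
  eclosed_ball c r `<=` U -> C2_on U f -> unit_normal_field U f N ->
  eclosed_ball c r x -> Num.sg (normal_height N x) = Num.sg (normal_height N c).
Proof.
move=> r0 BU hf hN Bx.
pose l (t : R) : 'rV[R]_n := c + t *: (x - c).
pose nu t := normal_height N (l t).
have Bl t : t \in `[0, 1]%R -> U (l t).
  rewrite in_itv/= => /andP[t0 t1]; apply: BU; move: Bx; rewrite !eclosed_ballE//= => Bx.
  rewrite /l addrAC subrr add0r dotprodZl dotprodZr mulrA -expr2.
  by apply: le_trans Bx; rewrite ler_piMl ?dotprod_ge0// expr_le1.
have nuc : {within `[0, 1], continuous nu}.
  apply: continuous_in_subspaceT => t /set_mem /= /Bl Ut.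
  apply: (@continuous_comp _ _ _ l (normal_height N)).
    by apply: continuousD; [exact: cst_continuous|exact: scalel_continuous].
  exact: normal_height_continuous hN _ Ut.
have nu0 : nu 0 = normal_height N c by rewrite /nu /l scale0r addr0.
have nu1 : nu 1 = normal_height N x by rewrite /nu /l scale1r addrC subrK.
have no0 t : t \in `[0, 1]%R -> nu t != 0.
  by move=> /Bl Ut; exact: (normal_height_neq0 hf hN Ut).
have := no0 0 ltac:(by rewrite in_itv/= lexx ler01).
have := no0 1 ltac:(by rewrite in_itv/= lexx ler01).
have ivt := @IVT R nu 0 1 0 ler01 nuc.
rewrite -nu0 -nu1; case: (ltgtP (nu 0) 0) => // h0; case: (ltgtP (nu 1) 0) => // h1 _ _.
- by rewrite !ltr0_sg.
- case: ivt => [|t /no0 + t0]; last by rewrite t0 eqxx.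
  by rewrite ge_min le_max (ltW h0) (ltW h1) orbT.
- case: ivt => [|t /no0 + t0]; last by rewrite t0 eqxx.
  by rewrite ge_min le_max (ltW h0) (ltW h1) orbT.
- by rewrite !gtr0_sg.
Qed.

Theorem theorem1p6 (R : realType) (n : nat) (hn : (2 <= n)%N)
    (r : R) (hr : 0 < r) (c : 'rV[R]_n)
    (U : set 'rV[R]_n) (hU : open U) (hBU : eclosed_ball c r `<=` U)
    (f : 'rV[R]_n -> R) (hf : C2_on U f)
    (N : 'rV[R]_n -> 'rV[R]_(n + 1)) (hN : unit_normal_field U f N)
    (hH : (forall x, eclosed_ball c r x -> 0 <= mean_curvature f N x) \/
          (forall x, eclosed_ball c r x -> mean_curvature f N x <= 0)) :
  inf [set second_form_length f N x | x in eclosed_ball c r] < n%:R / r.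
Proof.
have [s s2 {}hH] : exists2 s : R, s ^+ 2 = 1 &
    forall x, eclosed_ball c r x -> 0 <= s * mean_curvature f N x.
  case: hH => hH; first by exists 1; rewrite ?expr1n// => x /hH; rewrite mul1r.
  by exists (-1); rewrite ?sqrrN ?expr1n// => x /hH; rewrite mulN1r oppr_ge0.
pose nu := normal_height N; pose e := Num.sg (nu c).
have Bc : eclosed_ball c r c.
  by rewrite eclosed_ballE//= subrr dotprodE mul0mx mxE sqr_ge0.
have e2 : e ^+ 2 = 1.
  by rewrite /e sqr_sg (normal_height_neq0 hf hN (hBU _ Bc)).
(* The sign [s] is that of the mean curvature and [e] that of [nu] on the whole ball. Since
   [S G = nu Hess f], touching with [s * e] bounds from above the curvatures multiplied by [s]. *)
have [x [m [Bx m0 mE mH]]] := touching_hemisphere hr (s * e) hU hBU hf.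
have Ux := hBU _ Bx; have [df dp _] := hf _ Ux.
have se2 : (s * e) ^+ 2 = 1 by rewrite exprMn s2 e2 mulr1.
rewrite se2 mul1r in mE.
(* Both [m / r] and [|nu x|] are the positive root of [z ^+ 2 * (1 + |grad f|^2) = 1]. *)
have mnu : m = r * (e * nu x).
  have -> : e * nu x = `|nu x|.
    by rewrite normrEsg (normal_height_sign hr hBU hf hN Bx).
  apply/eqP; rewrite -(@eqrXn2 _ 2) ?mulr_ge0 ?(ltW m0) ?(ltW hr)//.
  rewrite exprMn real_normK ?num_real// -mE -mulrA (mulrC (1 + _)).
  by rewrite (normal_height_sqr hf hN Ux) mulr1.
set S := shape_operator f N x; set G := gram f x; set h := nu x *: 'J (gradient f) x.
have SG : S *m G = h by exact: shape_operator_gram hU hf hN _ Ux.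
have GT : G^T = G by rewrite /G /gram linearD/= trmx1 trmx_mul trmxK.
have hT : h^T = h.
  rewrite /h linearZ/= hessian_sym//.
  by apply: filterS (near_domain hU Ux) => y Uy; have [] := hf _ Uy.
have GE u : dotprod (u *m G) u = dotprod u u + dotprod u (gradient f x) ^+ 2.
  by rewrite mul_gram dotprodDl dotprodZl [dotprod (gradient f x) u]dotprodC -expr2.
have Gpos u : u != 0 -> 0 < dotprod (u *m G) u.
  by move=> u0; rewrite GE ltr_wpDr ?sqr_ge0 ?dotprod_gt0.
have [k [kE trE kev]] := pencil_spectrum (ltnW hn) SG GT hT Gpos.
(* Evaluate the second-order inequality at an eigenvector [u] for [a]: its right side is the squared
   length of [u] in the metric [G], and its left side is [r * s * a] times the same positive
   number. *)
have kle a : a \in k -> s * a <= r^-1.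
  move=> /kev[u u0 uh].
  have := mH u; rewrite se2 mul1r -GE mnu.
  have -> : r * (e * nu x) * (s * e * dotprod (u *m 'J (gradient f) x) u) =
      r * e ^+ 2 * (s * dotprod (u *m h) u).
    by rewrite /h -scalemxAr dotprodZl; ring.
  rewrite e2 mulr1 uh dotprodZl => le.
  rewrite -[r^-1]mul1r ler_pdivlMr// -(ler_pM2r (Gpos _ u0)) mul1r.
  by apply: le_trans le; rewrite le_eqVlt; apply/orP; left; apply/eqP; ring.
pose k' := [tuple of map ( *%R s) k].
have k'le a : a \in k' -> a <= r^-1 by move=> /mapP[b /kle + ->].
have n0 : 0 < n%:R :> R by rewrite ltr0n ltnW.
have k'ge0 : 0 <= \sum_(a <- k') a.
  rewrite big_map -mulr_sumr; have := hH _ Bx; rewrite (mean_curvatureE kE).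
  by rewrite mulrCA pmulr_rge0// invr_gt0.
have ri0 : 0 < r^-1 by rewrite invr_gt0.
have := sum_sqr_le hn (ltW ri0) k'le k'ge0.
have -> : \sum_(a <- k') a ^+ 2 = \tr (S *m S).
  by rewrite trE big_map; apply: eq_bigr => a _; rewrite exprMn s2 mul1r.
(* The contact point alone witnesses the strict bound: there the squared length is at most
   [n (n - 1) / r ^+ 2]. *)
move=> trle; apply: (@le_lt_trans _ _ (second_form_length f N x)).
  apply: ge_inf; last by exists x.
  by exists 0 => _ [y _ <-]; exact: sqrtr_ge0.
rewrite /second_form_length -/S -[ltRHS]ger0_norm ?divr_ge0 ?(ltW hr)//.
rewrite -sqrtr_sqr ltr_sqrt ?exprn_gt0 ?divr_gt0//.
apply: le_lt_trans trle _; rewrite exprMn ltr_pM2r ?exprn_gt0// expr2 ltr_pM2l//.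
by lra.
Qed.
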